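(* Let $N\ge 1$. There is a constant $C_N^{(1)}$ depending only on $N$ such that the following holds. Let $S$ be a real symmetric positive definite $N\times N$ matrix, and for $J\in\mathcal{A}_N(\mathbb{R})$ define $B_J=(I+J)S$. Then $$\max_{J\in\mathcal{A}_N(\mathbb{R})}\ \min \mathrm{Re}\,\big(\sigma(B_J)\big)=\frac{\mathrm{Tr}(S)}{N},$$ and in particular there exist matrices $J_{opt}\in\mathcal{A}_N(\mathbb{R})$ for which this maximum is attained. Furthermore, the matrix $J_{opt}$ attaining the maximum can be chosen so that for all $t\ge 0$ $$\left\|e^{-(I+J_{opt})St}\right\|\le C_N^{(1)}\,\kappa(S)^{1/2}\exp\left(-\frac{\mathrm{Tr}(S)}{N}t\right).$$
   Context: $\mathcal{A}_N(\mathbb{R})$ is the set of real antisymmetric $N\times N$ matrices ($J^T=-J$), $I$ is the identity matrix, $\sigma(M)$ is the (complex) spectrum of $M$, and $\min\mathrm{Re}(\sigma(M))$ is the minimum of the real parts of the eigenvalues of $M$. $\|\cdot\|$ is the matrix norm induced by the Euclidean norm on $\mathbb{R}^N$, and $\kappa(M)=\|M\|\,\|M^{-1}\|$ is the condition number. *)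

(* Defs.v *)
From HB Require Import structures.
From mathcomp Require Import all_boot all_order all_algebra.
From mathcomp Require Import all_classical all_reals all_analysis.
From mathcomp Require Import complex.
Set Implicit Arguments.
Unset Strict Implicit.
Unset Printing Implicit Defensive.
Import Order.TTheory GRing.Theory Num.Theory.
Import numFieldNormedType.Exports.
Local Open Scope classical_set_scope.
Local Open Scope ring_scope.

Definition is_max (R : realType) (A : set R) (m : R) : Prop :=
  A m /\ ubound A m.

Definition posdefmx (R : realType) (n : nat) (S : 'M[R]_n) : Prop :=
  S^T = S /\ forall x : 'cV[R]_n, x != 0 -> 0 < (x^T *m S *m x) 0 0.

Definition antisymmx (R : realType) (n : nat) : set 'M[R]_n :=
  [set J | J^T = - J].

(* The library's [eigenvalue] is relative to the coefficient field, so the real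
   matrix is first mapped into R[i]. *)
Definition spectrum (R : realType) (n : nat) (M : 'M[R]_n) : set R[i] :=
  [set z | eigenvalue (map_mx (real_complex R) M) z].

(* For 0 < n this infimum is a minimum: see [min_ReP]. *)
Definition min_Re (R : realType) (n : nat) (M : 'M[R]_n) : R :=
  inf [set complex.Re z | z in spectrum M].

Definition euclid_norm (R : realType) (n : nat) (x : 'cV[R]_n) : R :=
  Num.sqrt (\sum_(i < n) x i 0 ^+ 2).

(* The library's norm `|A| on matrices is the entrywise sup norm, hence a
   separate definition of the norm induced by the Euclidean one. *)
Definition opnorm (R : realType) (n : nat) (A : 'M[R]_n) : R :=
  sup [set euclid_norm (A *m x) | x in [set x : 'cV[R]_n | euclid_norm x <= 1]].

Definition cond_number (R : realType) (n : nat) (A : 'M[R]_n) : R :=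
  opnorm A * opnorm (invmx A).

Definition expmx (R : realType) (n : nat) (A : 'M[R]_n) : 'M[R]_n :=
  limn (series (fun k : nat => (k`!%:R)^-1 *: A ^+ k)).

Lemma min_ReP (R : realType) (n : nat) (M : 'M[R]_n) : (0 < n)%N ->
  [set complex.Re z | z in spectrum M] (min_Re M) /\
  lbound [set complex.Re z | z in spectrum M] (min_Re M).
Proof.
case: n M => // n M _; set E := [set _ | _ in _].
pose p := char_poly (map_mx (real_complex R) M).
have [r pE] := closed_field_poly_normal p.
have p_mon : lead_coef p = 1 by apply/monicP; exact: char_poly_monic.
have specE z : spectrum M z <-> z \in r.
  by rewrite /spectrum /= eigenvalue_root_char -/p pE p_mon scale1r root_prod_XsubC.
have r0 : r != [::].
  apply/eqP => r0; have := size_char_poly (map_mx (real_complex R) M).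
  by rewrite -/p pE p_mon scale1r r0 big_nil size_poly1.
have [m Em mE] : exists2 m, E m & lbound E m.
  have [z zr zP] : exists2 z, z \in r &
      forall w, w \in r -> complex.Re z <= complex.Re w.
    elim: (r) r0 => // a s IH _; have [->|/IH[z zs zP]] := eqVneq s [::].
      by exists a; rewrite ?mem_head// => w; rewrite inE => /eqP ->.
    have [az|/ltW za] := leP (complex.Re a) (complex.Re z).
      exists a; first exact: mem_head.
      move=> w; rewrite inE => /predU1P[->//|/zP]; exact: le_trans.
    exists z; first by rewrite inE zs orbT.
    by move=> w; rewrite inE => /predU1P[->//|/zP].
  exists (complex.Re z); first by exists z => //; apply/specE.
  by move=> _ [w /specE wr <-]; exact: zP.
suff -> : min_Re M = m by [].
apply/eqP; rewrite eq_le; apply/andP; split.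
  by apply: ge_inf => //; exists m.
by apply: lb_le_inf => //; exists m.
Qed.

(* Main.v *)
Require Import Defs.
From HB Require Import structures.
From mathcomp Require Import all_boot all_order all_algebra.
From mathcomp Require Import all_classical all_reals all_analysis.
From mathcomp Require Import complex.
From mathcomp Require Import ring lra.
Set Implicit Arguments.
Unset Strict Implicit.
Unset Printing Implicit Defensive.
Import Order.TTheory GRing.Theory Num.Theory.
Import numFieldNormedType.Exports.
Local Open Scope classical_set_scope.
Local Open Scope ring_scope.

(** Write S = X X^T and rotate the columns of X in pairs until they all have
    the same squared length m = Tr(S)/N, i.e. until T = X^T X has constant
    diagonal m.  With D = diag(1, ..., N) and the antisymmetric matrix
    K_kj = - (k + j)/(k - j) T_kj, one gets
    (T + K)^T D + D (T + K) = 2 m D.  Conjugating by X, the matrix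
    J = X^-T K X^-1 gives B = (I + J) S and P = X D X^T with
    B^T P + P B = 2 m P.  Hence every eigenvalue of B has real part m, and
    x^T P x decays exactly like exp (- 2 m t) along the flow of - B.  Since
    |X^T x|^2 <= x^T P x <= N |X^T x|^2 and S = X X^T, this yields the estimate
    with constant sqrt N.  The bound min Re <= m for arbitrary J holds
    because Tr (J S) = 0, so that the mean of the eigenvalues is m. *)

(** * Factorization S = X X^T of a positive definite matrix *)

Section Cholesky.
Variable R : realType.

(** Induction on the size. With corner a and the column b below it, the Schur complement
    [S' - a^-1 *: (b *m b^T)] is again positive definite; if it is Y Y^T, then X has the blocks sqrt
    a, 0, b / sqrt a and Y. *)
Lemma posdefmx_cholesky n (S : 'M[R]_n) : posdefmx S ->
  exists X : 'M[R]_n, S = X *m X^T.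
Proof.
elim: n S => [|n IH] S [Ssym Spos].
  by exists 0; apply/matrixP => - [].
rewrite -[n.+1]/(1 + n)%N in S Ssym Spos *.
pose a := S 0 0; pose b := dlsubmx S; pose S' := drsubmx S.
have ula : ulsubmx S = a%:M.
  rewrite [ulsubmx S]mx11_scalar /ulsubmx !mxE; congr (S _ _)%:M; exact/val_inj.
have urb : ursubmx S = b^T by rewrite /b trmx_dlsub Ssym.
have S'sym : S'^T = S' by rewrite /S' trmx_drsub Ssym.
have SE : S = block_mx a%:M b^T b S' by rewrite -[LHS]submxK ula urb.
have a_gt0 : 0 < a.
  have := Spos (col_mx 1%:M 0).
  rewrite SE tr_col_mx mul_row_block mul_row_col !trmx1 !trmx0.
  rewrite !mul1mx !mulmx0 !mul0mx !addr0 mulmx1 mxE mulr1n; apply.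
  apply/eqP => /(congr1 usubmx); rewrite col_mxKu => /matrixP/(_ 0 0)/eqP.
  by rewrite !mxE /= oner_eq0.
have a_neq0 : a != 0 by rewrite gt_eqF.
have [|Y YP] := IH (S' - a^-1 *: (b *m b^T)).
  split; first by rewrite linearB linearZ /= trmx_mul trmxK S'sym.
  move=> x x0; pose c := (b^T *m x) 0 0.
  have cE : b^T *m x = c%:M by rewrite [LHS]mx11_scalar.
  have cE' : x^T *m b = c%:M.
    by rewrite -[LHS]trmxK trmx_mul trmxK cE tr_scalar_mx.
  (* For fixed x, - c / a is the first coordinate that minimizes the quadratic form of S; the
     minimum is the form of the Schur complement at x. *)
  have /Spos : col_mx (- (a^-1 * c))%:M x != 0.
    apply: contra_neq x0 => /(congr1 dsubmx); rewrite col_mxKd => ->.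
    by apply/matrixP => i j; rewrite !mxE.
  rewrite SE tr_col_mx mul_row_block mul_row_col tr_scalar_mx.
  rewrite mulmxDl mulmxDl mulmxBr mulmxBl -scalemxAr -scalemxAl.
  rewrite !mulmxA cE' -!mulmxA cE -!scalar_mxM.
  set q := x^T *m (S' *m x).
  rewrite !mxE ?mulr1n; set w := \sum_j _ => wP.
  by apply: etrans wP; congr (0 < _); field.
exists (block_mx (Num.sqrt a)%:M 0 ((Num.sqrt a)^-1 *: b) Y).
rewrite tr_block_mx mulmx_block !trmx0 !mul0mx !mulmx0 !addr0 tr_scalar_mx.
rewrite -scalar_mxM -YP linearZ /= -expr2 sqr_sqrtr ?(ltW a_gt0) //.
rewrite mul_scalar_mx mul_mx_scalar !scalerA mulfV ?mulVf ?sqrtr_eq0 -?ltNge //.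
rewrite -scalemxAl -scalemxAr scalerA -invfM -expr2 sqr_sqrtr ?(ltW a_gt0) //.
by rewrite !scale1r addrC subrK.
Qed.

End Cholesky.

(** * Equalizing the column lengths by plane rotations *)

Section EqualizeDiagonal.
Variable R : realType.

Definition colnorm2 n (X : 'M[R]_n) k := \sum_p X p k ^+ 2.

Lemma mxtrace_mulmx_tr n (X : 'M[R]_n) : \tr (X *m X^T) = \sum_k colnorm2 X k.
Proof.
rewrite /mxtrace exchange_big; apply: eq_bigr => i _; rewrite mxE.
by apply: eq_bigr => j _; rewrite !mxE.
Qed.

(** Rotating a pair of columns multiplies X on the right by an orthogonal matrix, so X X^T is kept.
    Since m lies between the two squared lengths, some angle gives column i the squared length m. *)
Lemma rotate_columns n (X : 'M[R]_n) i j m : i != j ->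
    colnorm2 X i < m -> m < colnorm2 X j ->
  exists2 Y : 'M[R]_n, Y *m Y^T = X *m X^T &
    colnorm2 Y i = m /\
    forall k, k != i -> k != j -> colnorm2 Y k = colnorm2 X k.
Proof.
move=> ij im mj.
pose b := \sum_p X p i * X p j.
pose a := colnorm2 X i - m; pose d := colnorm2 X j - m.
have a0 : a < 0 by rewrite subr_lt0.
have d0 : 0 < d by rewrite subr_gt0.
(* [t] is the tangent of the rotation angle that makes the new column [i] have
   squared length [m]. *)
have [t tP] : exists t, a + 2 * b * t + d * t ^+ 2 = 0.
  exists ((- b + Num.sqrt (b ^+ 2 - a * d)) / d).
  set s := Num.sqrt _.
  have s2 : s ^+ 2 = b ^+ 2 - a * d.
    rewrite sqr_sqrtr // subr_ge0 (le_trans _ (sqr_ge0 b)) //.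
    by rewrite nmulr_rle0 // ltW.
  have dn0 : d != 0 by rewrite gt_eqF.
  by field: s2.
have t1 : 0 < 1 + t ^+ 2 by rewrite ltr_pwDl // sqr_ge0.
(* [c] and [s] are the cosine and sine of the angle with tangent [t]. *)
pose c := (Num.sqrt (1 + t ^+ 2))^-1; pose s := t * c.
have c2 : c ^+ 2 * (1 + t ^+ 2) = 1.
  by rewrite exprVn sqr_sqrtr ?(ltW t1) // mulVf // gt_eqF.
have cs : c ^+ 2 + s ^+ 2 = 1 by rewrite -c2 /s; ring.
pose Y := \matrix_(p, k) if k == i then c * X p i + s * X p j
   else if k == j then - s * X p i + c * X p j else X p k.
have ji : j != i by rewrite eq_sym.
exists Y.
  apply/matrixP => p q; rewrite !mxE (bigD1 i) //= (bigD1 j) //=.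
  rewrite [RHS](bigD1 i) //= [X in _ = _ + X](bigD1 j) //= !addrA.
  congr (_ + _); last first.
    by apply: eq_bigr => k /andP[/negPf ki /negPf kj]; rewrite !mxE ki kj.
  rewrite !mxE !eqxx (negPf ji).
  transitivity ((c ^+ 2 + s ^+ 2) * (X p i * X q i + X p j * X q j)).
    by ring.
  by rewrite cs mul1r.
split.
  have -> : colnorm2 Y i =
      c ^+ 2 * colnorm2 X i + 2 * c * s * b + s ^+ 2 * colnorm2 X j.
    rewrite /colnorm2 /b !mulr_sumr -!big_split; apply: eq_bigr => p _.
    by rewrite /= !mxE eqxx; ring.
  apply/eqP; rewrite -subr_eq0; apply/eqP.
  transitivity
      (c ^+ 2 * (a + 2 * b * t + d * t ^+ 2) + m * (c ^+ 2 + s ^+ 2 - 1)).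
    by rewrite /a /d /s; ring.
  by rewrite tP cs subrr !mulr0 addr0.
move=> k /negPf ki /negPf kj; apply: eq_bigr => p _.
by rewrite mxE ki kj.
Qed.

(** The common value m is the mean of the squared column lengths. As long as they are not all m, one
    lies below m and one above; rotating this pair makes one more of them equal to m. *)
Lemma exists_equal_colnorm n (X : 'M[R]_n) :
  exists2 Y : 'M[R]_n, Y *m Y^T = X *m X^T &
    forall k, colnorm2 Y k = \tr (X *m X^T) / n%:R.
Proof.
set m := _ / _.
have sum0 (Y : 'M[R]_n) : Y *m Y^T = X *m X^T -> \sum_k (colnorm2 Y k - m) = 0.
  move=> YX; rewrite sumrB -mxtrace_mulmx_tr YX sumr_const card_ord /m.
  have [n0|n0] := posnP n; last first.
    by rewrite -[_ *+ n]mulr_natr divfK ?subrr // pnatr_eq0 -lt0n.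
  (* For n = 0 the value m is a division by zero, but the trace is then an empty sum. *)
  have -> : \tr (X *m X^T) = 0.
    by apply: big1 => k _; have := ltn_ord k; rewrite {2}n0.
  by rewrite mul0r mul0rn subr0.
(* Induction on a strict bound [r] for the number of columns still to be corrected. *)
suff rotations r Z : Z *m Z^T = X *m X^T ->
    (#|[pred k | colnorm2 Z k != m]| < r)%N ->
    exists2 Y, Y *m Y^T = X *m X^T & forall k, colnorm2 Y k = m.
  exact: (rotations _ X erefl (ltnSn _)).
elim: r Z => // r IH Z ZX Zr.
have [/existsP[i im]|/existsPn mi] := boolP [exists i, colnorm2 Z i < m];
  last first.
  exists Z => // k; apply/eqP; rewrite -subr_eq0.
  have mi' l : 0 <= colnorm2 Z l - m by rewrite subr_ge0 leNgt mi.
  have /eqP := sum0 _ ZX; rewrite psumr_eq0 // => /allP; apply.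
  by rewrite mem_index_enum.
have [/existsP[j mj]|/existsPn jm] := boolP [exists j, m < colnorm2 Z j];
  last first.
  have : \sum_k (colnorm2 Z k - m) < 0.
    rewrite (bigD1 i) //= ltr_nwDl ?subr_lt0 // sumr_le0 // => k _.
    by rewrite subr_le0 leNgt jm.
  by rewrite sum0 // ltxx.
have ij : i != j by apply: contraTneq im => ->; rewrite -leNgt ltW.
have [Y YZ [Yi Yk]] := rotate_columns ij im mj.
apply: (IH Y); first by rewrite YZ.
(* Column i leaves the set of columns to be corrected, and column j already belonged to it. *)
rewrite ltnS in Zr; apply: leq_trans Zr; apply/proper_card/properP; split.
  apply/fintype.subsetP => k; rewrite !inE.
  have [->|ki] := eqVneq k i; first by rewrite Yi eqxx.
  by have [->|kj] := eqVneq k j; [move=> _; rewrite gt_eqF | rewrite Yk].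
by exists i; rewrite !inE ?Yi ?eqxx // lt_eqF.
Qed.

End EqualizeDiagonal.

(** * The matrix exponential and its derivative *)

Section MatrixExponential.
Variable R : realType.

Lemma cvg_mx_entries m n (u : nat -> 'M[R]_(m, n)) (L : 'M[R]_(m, n)) :
  (forall i j, (fun k => u k i j) @ \oo --> L i j) -> u @ \oo --> L.
Proof.
move=> uL A [P LP sPA].
have : \forall k \near \oo, forall i j, P i j (u k i j).
  by apply: filter_forall => i; apply: filter_forall => j; exact: uL (LP i j).
by apply: filterS => k Pk; exact: sPA.
Qed.

(** A crude matrix norm that serves to dominate the entries of the powers of A. *)
Definition absum n (A : 'M[R]_n) : R := \sum_i \sum_j `|A i j|.

Lemma absum_ge0 n (A : 'M[R]_n) : 0 <= absum A.
Proof. by apply: sumr_ge0 => i _; apply: sumr_ge0. Qed.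

Lemma exprmx_entry_le n (A : 'M[R]_n) k i j : `|(A ^+ k) i j| <= absum A ^+ k.
Proof.
elim: k i j => [|k IH] i j.
  by rewrite !expr0 mxE; case: eqP => _; rewrite ?normr1 ?normr0 ?ler01.
rewrite !exprS mxE; apply: (le_trans (ler_norm_sum _ _ _)).
have : \sum_l `|A i l| * absum A ^+ k <= absum A * absum A ^+ k.
  rewrite -mulr_suml ler_wpM2r ?exprn_ge0 ?absum_ge0 //.
  rewrite [leRHS](bigD1 i) //= lerDl; apply: sumr_ge0 => l _.
  exact: sumr_ge0.
apply: le_trans; apply: ler_sum => l _.
by rewrite normrM ler_wpM2l.
Qed.

(** Power series coefficients in x of entry (i, j) of A^p exp(x A). The shift p makes the family
    closed under termwise differentiation. *)
Definition expmx_coef n (A : 'M[R]_n) p i j : R^nat :=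
  fun k => k`!%:R^-1 * (A ^+ (k + p)) i j.

(** Comparison with [absum A ^+ p] times the exponential series at [absum A] |x|. *)
Lemma is_cvg_expmx_coef n (A : 'M[R]_n) p i j x :
  cvgn (pseries (expmx_coef A p i j) x).
Proof.
apply: normed_cvg.
pose v k := (absum A ^+ p) * exp_coeff (absum A * `|x|) k.
have v0 k : 0 <= v k.
  rewrite mulr_ge0 ?exprn_ge0 ?absum_ge0 //.
  by rewrite /exp_coeff divr_ge0 ?exprn_ge0 ?mulr_ge0 ?absum_ge0.
apply: (@series_le_cvg _ _ v) => [k|//|k|]; first exact: normr_ge0.
  rewrite /= /expmx_coef.
  rewrite !normrM normfV normr_nat normrX /v /exp_coeff /=.
  rewrite exprMn (_ : absum A ^+ p * _ =
    k`!%:R^-1 * absum A ^+ (k + p) * `|x| ^+ k); last by rewrite exprD; ring.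
  by rewrite ler_wpM2r ?exprn_ge0 // ler_wpM2l ?invr_ge0 // exprmx_entry_le.
have -> : v = absum A ^+ p *: exp_coeff (absum A * `|x|) by [].
exact/is_cvg_seriesZ/is_cvg_series_exp_coeff.
Qed.

Lemma exprmxZ n (A : 'M[R]_n) x k : (x *: A) ^+ k = x ^+ k *: A ^+ k.
Proof.
elim: k => [|k IH]; first by rewrite !expr0 scale1r.
by rewrite !exprS IH -[LHS]scalemxAl -scalemxAr scalerA.
Qed.

Lemma expmx_entry n (A : 'M[R]_n) x i j :
  expmx (x *: A) i j = limn (pseries (expmx_coef A 0 i j) x).
Proof.
pose L : 'M[R]_n := \matrix_(i, j) limn (pseries (expmx_coef A 0 i j) x).
suff -> : expmx (x *: A) = L by rewrite mxE.
apply/cvg_lim; first exact: norm_hausdorff.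
apply: cvg_mx_entries => {}i {}j; rewrite mxE.
rewrite [X in X @ _ --> _](_ : _ = pseries (expmx_coef A 0 i j) x).
  exact: is_cvg_expmx_coef.
apply/funext => k; rewrite /pseries /series /= summxE.
apply: eq_bigr => l _; rewrite /expmx_coef addn0. rewrite exprmxZ !mxE.
by ring.
Qed.

Lemma pseries_diffs_expmx_coef n (A : 'M[R]_n) p i j :
  pseries_diffs (expmx_coef A p i j) = expmx_coef A p.+1 i j.
Proof.
apply/funext => k; rewrite /pseries_diffs /expmx_coef factS natrM invfM.
by rewrite mulrA mulVKf ?pnatr_eq0 // addnS addSn.
Qed.

Global Instance is_derive_expmx n (A : 'M[R]_n) (x : R) i j :
  is_derive x 1 (fun x => expmx (x *: A) i j) ((A *m expmx (x *: A)) i j).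
Proof.
have -> : (fun x => expmx (x *: A) i j) =
          (fun x => limn (pseries (expmx_coef A 0 i j) x)).
  by apply/funext => y; rewrite expmx_entry.
have -> : (A *m expmx (x *: A)) i j =
          limn (pseries (pseries_diffs (expmx_coef A 0 i j)) x).
  rewrite pseries_diffs_expmx_coef; apply/esym/cvg_lim => //.
  rewrite [X in X @ _ --> _](_ : _ =
      fun k => \sum_l A i l *: pseries (expmx_coef A 0 l j) x k); last first.
    apply/funext => k; rewrite /pseries /series /=.
    under [RHS]eq_bigr do rewrite scaler_sumr.
    rewrite exchange_big; apply: eq_bigr => l _ /=.
    rewrite /expmx_coef addn0 addn1 exprS mxE mulr_sumr mulr_suml.
    by apply: eq_bigr => s _; rewrite /GRing.scale /=; ring.
  rewrite mxE; apply: (@cvg_big R^o _ +%R 0 xpredT (@add_continuous R^o)) => l _.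
  rewrite expmx_entry; apply: (@cvgZl_tmp _ R^o); exact: is_cvg_expmx_coef.
(* Termwise differentiation at x asks for convergence at a point of larger modulus; |x| + 1
   serves. *)
apply: (@pseries_snd_diffs _ _ (`|x| + 1)); rewrite ?pseries_diffs_expmx_coef;
  do ?exact: is_cvg_expmx_coef.
by rewrite [ltRHS]ger0_norm ?addr_ge0 // ltrDl.
Qed.

Lemma expmx0 n (A : 'M[R]_n) : expmx (0 *: A) = 1%:M.
Proof.
apply/cvg_lim; first exact: norm_hausdorff.
(* The partial sum of index 0 is empty; from index 1 on the partial sums are constantly 1. *)
rewrite -cvg_shiftS; apply: cvg_near_cst; near=> k.
rewrite /series /= big_nat_recl // expr0 fact0 invr1 scale1r big1 ?addr0 //.
by move=> l _; rewrite scale0r expr0n scaler0.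
Unshelve. all: by end_near. Qed.

(** With E = exp(t B), the entries of exp(- m t) E^T P E have derivative zero by the hypothesis on
    P, and at t = 0 they are those of P. *)
Lemma expmx_congr_scale n (B P : 'M[R]_n) (m t : R) :
    B^T *m P + P *m B = m *: P ->
  (expmx (t *: B))^T *m P *m expmx (t *: B) = expR (m * t) *: P.
Proof.
move=> BP; pose E t := expmx (t *: B).
pose f i j t := expR (- m * t) * ((E t)^T *m P *m E t) i j.
suff fP i j : f i j t = f i j 0.
  apply/matrixP => i j; move: (fP i j).
  rewrite /f /E expmx0 trmx1 mul1mx mulmx1 mulr0 expR0 mul1r => fPij; rewrite [RHS]mxE -fPij.
  by rewrite mulrA -expRD mulNr addrN expR0 mul1r.
apply: is_derive_0_is_cst => {}t.
have dE k l : is_derive t 1 (fun t => E t k l) ((B *m E t) k l).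
  exact: is_derive_expmx.
have dq : is_derive t 1 (fun t => ((E t)^T *m P *m E t) i j)
    (((B *m E t)^T *m P *m E t + (E t)^T *m P *m (B *m E t)) i j).
  (* The entry is expanded into a finite sum of products of entries of E, to which the scalar
     derivation rules apply. *)
  have -> : (fun t => ((E t)^T *m P *m E t) i j) =
     \sum_k \sum_l P l k *: ((fun t => E t l i) * (fun t => E t k j)).
    apply/funext => s; rewrite fct_sumE mxE; apply: eq_bigr => k _.
    rewrite fct_sumE mxE mulr_suml; apply: eq_bigr => l _.
    by rewrite mxE -mulrA mulrCA.
  apply: is_derive_eq; rewrite !mxE -big_split; apply: eq_bigr => k _.
  rewrite !mxE /= !mulr_suml -big_split /=; apply: eq_bigr => l _.
  by rewrite !mxE /GRing.scale /=; ring.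
have de : is_derive t 1 (fun t => expR (- m * t)) (- m * expR (- m * t)).
  by apply: is_derive_eq; rewrite /GRing.scale /=; ring.
apply: is_derive_eq.
have -> : (B *m E t)^T *m P *m E t + (E t)^T *m P *m (B *m E t) =
   m *: ((E t)^T *m P *m E t).
  rewrite trmx_mul -!mulmxA -mulmxDr !mulmxA -mulmxDl BP.
  by rewrite -scalemxAl -scalemxAr mulmxA.
by rewrite mxE /GRing.scale /=; ring.
Qed.

End MatrixExponential.

(** * The trace bound, and the spectrum under a Lyapunov identity *)

Section Spectrum.
Variable R : realType.

(** The trace is the sum of the n complex eigenvalues counted with multiplicity, so the right-hand
    side is the mean of their real parts. *)
Lemma min_Re_le_trace n (M : 'M[R]_n) : (0 < n)%N -> min_Re M <= \tr M / n%:R.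
Proof.
move=> n0; have [_ minP] := min_ReP M n0.
set p := char_poly (map_mx (real_complex R) M).
have [r pE] := closed_field_poly_normal p.
rewrite (monicP (char_poly_monic _)) scale1r in pE.
have rn : size r = n.
  by apply: succn_inj; rewrite -(size_prod_XsubC r id) -pE size_char_poly.
have trE : \tr (map_mx (real_complex R) M) = \sum_(z <- r) z.
  apply: oppr_inj; rewrite -char_poly_trace // -/p pE -coefPn_prod_XsubC ?rn //.
  by rewrite -lt0n.
have -> : \tr M = \sum_(z <- r) complex.Re z.
  by rewrite -(raddf_sum (@complex.Re R)) -trE trace_map_mx.
have sumE : \sum_(z <- r) min_Re M = min_Re M * n%:R.
  by rewrite big_const_seq count_predT rn iter_addr_0 mulr_natr.
rewrite ler_pdivlMr ?ltr0n // -sumE.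
rewrite big_seq [leRHS]big_seq; apply: ler_sum => z zr.
apply: minP; exists z => //.
by rewrite /spectrum /= eigenvalue_root_char -/p pE root_prod_XsubC.
Qed.

(** [eigenvalue] refers to row eigenvectors; passing to the transpose provides column
    eigenvectors. *)
Lemma char_poly_tr (F : comNzRingType) n (A : 'M[F]_n) :
  char_poly A^T = char_poly A.
Proof.
rewrite /char_poly -det_tr; congr (\det _).
by rewrite /char_poly_mx linearB /= tr_scalar_mx map_trmx trmxK.
Qed.

(** Let x + i y be an eigenvector for a + i b and q the bilinear form of P. The identity gives q(u,
    B u) = m q(u, u) for u = x and u = y; in the sum of the two the terms in b cancel, and a = m
    remains. *)
Lemma spectrum_lyapunov n (B P : 'M[R]_n) m z : posdefmx P ->
  B^T *m P + P *m B = (2 * m) *: P -> spectrum B z -> complex.Re z = m.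
Proof.
move=> [Psym Ppos] BP; rewrite /spectrum /= eigenvalue_root_char -char_poly_tr.
rewrite -eigenvalue_root_char => /eigenvalueP[v vB v0].
pose x := (map_mx (@complex.Re R) v)^T; pose y := (map_mx (@complex.Im R) v)^T.
case: z vB => a b vB /=.
have Bx : B *m x = a *: x - b *: y.
  apply/matrixP => i j; rewrite ord1 !mxE.
  have := congr1 (fun w : 'rV_n => complex.Re (w 0 i)) vB.
  rewrite !mxE raddf_sum /=; case: (v 0 i) => vx vy /= <-.
  apply: eq_bigr => k _; rewrite !mxE; case: (v 0 k) => ? ? /=; ring.
have By : B *m y = b *: x + a *: y.
  apply/matrixP => i j; rewrite ord1 !mxE.
  have := congr1 (fun w : 'rV_n => complex.Im (w 0 i)) vB.
  rewrite !mxE raddf_sum /=; case: (v 0 i) => vx vy /=; rewrite addrC => <-.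
  apply: eq_bigr => k _; rewrite !mxE; case: (v 0 k) => ? ? /=; ring.
pose q (u w : 'cV[R]_n) : R := (u^T *m P *m w) 0 0.
have qC u w : q u w = q w u.
  by rewrite /q -[u^T *m P *m w]trmxK mxE trmx_mul trmx_mul trmxK Psym mulmxA.
have qB u : q u (B *m u) = m * q u u.
  apply: (@mulfI _ 2); first by rewrite pnatr_eq0.
  transitivity ((u^T *m (B^T *m P + P *m B) *m u) 0 0).
    rewrite mulmxDr mulmxDl mxE !mulmxA mulr_natl mulr2n {1}qC /q trmx_mul.
    by rewrite !mulmxA.
  by rewrite BP -scalemxAr -scalemxAl mxE mulrA.
have q0 : 0 < q x x + q y y.
  have q_ge0 u : 0 <= q u u.
    by have [->|/Ppos/ltW//] := eqVneq u 0; rewrite /q mulmx0 mxE.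
  have [x0|/Ppos qx] := eqVneq x 0; last by rewrite ltr_pwDl.
  have [y0|/Ppos qy] := eqVneq y 0; last by rewrite ltr_wpDl.
  case/eqP: v0; apply/matrixP => i j; rewrite ord1 mxE.
  have := congr1 (fun w : 'cV_n => w j 0) x0.
  have := congr1 (fun w : 'cV_n => w j 0) y0.
  by rewrite !mxE; case: (v 0 j) => ? ? /= -> ->.
have qx : q x (B *m x) = a * q x x - b * q x y.
  by rewrite Bx /q mulmxBr -!scalemxAr !mxE.
have qy : q y (B *m y) = b * q x y + a * q y y.
  by rewrite By [q x y]qC /q mulmxDr -!scalemxAr !mxE.
rewrite !qB in qx qy.
apply: (mulIf (lt0r_neq0 q0)).
by lra.
Qed.

End Spectrum.

(** * Euclidean and operator norms *)

Section OperatorNorm.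
Variable R : realType.

Definition dotmx n (x y : 'cV[R]_n) : R := (x^T *m y) 0 0.

Lemma dotmxE n (x y : 'cV[R]_n) : dotmx x y = \sum_i x i 0 * y i 0.
Proof. by rewrite /dotmx mxE; apply: eq_bigr => i _; rewrite mxE. Qed.

Lemma euclid_norm_ge0 n (x : 'cV[R]_n) : 0 <= euclid_norm x.
Proof. exact: sqrtr_ge0. Qed.

Lemma sqr_euclid_norm n (x : 'cV[R]_n) : euclid_norm x ^+ 2 = dotmx x x.
Proof.
rewrite sqr_sqrtr ?sumr_ge0 // => [|i _]; last exact: sqr_ge0.
by rewrite dotmxE; apply: eq_bigr => i _; rewrite expr2.
Qed.

Lemma euclid_norm_sqr_le n (x : 'cV[R]_n) c : 0 <= c ->
  (euclid_norm x <= c) = (dotmx x x <= c ^+ 2).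
Proof.
by move=> c0; rewrite -sqr_euclid_norm ler_sqr // nnegrE euclid_norm_ge0.
Qed.

Lemma euclid_normZ n (x : 'cV[R]_n) c :
  euclid_norm (c *: x) = `|c| * euclid_norm x.
Proof.
rewrite /euclid_norm -sqrtr_sqr -sqrtrM ?sqr_ge0 // mulr_sumr.
by congr Num.sqrt; apply: eq_bigr => i _; rewrite mxE exprMn.
Qed.

Lemma euclid_norm_eq0 n (x : 'cV[R]_n) : (euclid_norm x == 0) = (x == 0).
Proof.
apply/eqP/eqP => [x0|->]; last first.
  by rewrite /euclid_norm big1 ?sqrtr0 // => i _; rewrite mxE expr0n.
apply/matrixP => i j; rewrite ord1 mxE; apply/eqP; rewrite -sqrf_eq0.
have := sqr_euclid_norm x; rewrite x0 expr0n /= dotmxE => /esym/eqP.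
rewrite psumr_eq0 => [/allP/(_ i)|k _]; last exact: sqr_ge0.
by rewrite mem_index_enum => /(_ isT).
Qed.

Lemma dotmx_le n (x y : 'cV[R]_n) : dotmx x y <= euclid_norm x * euclid_norm y.
Proof.
have [xy0|/ltW xy0] := leP (dotmx x y) 0.
  by rewrite (le_trans xy0) // mulr_ge0 ?euclid_norm_ge0.
rewrite -(@ler_sqr _ (dotmx x y)) ?nnegrE ?mulr_ge0 ?euclid_norm_ge0 //.
rewrite exprMn !sqr_euclid_norm -(@ler_pM2l _ 2) // -subr_ge0.
(* Lagrange's identity *)
have -> : 2 * (dotmx x x * dotmx y y) - 2 * dotmx x y ^+ 2 =
   \sum_i \sum_j (x i 0 * y j 0 - x j 0 * y i 0) ^+ 2.
  rewrite mulr2n mulrDl mul1r {2}[dotmx x x * _]mulrC expr2.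
  rewrite !dotmxE !mulr_suml mulr_sumr -big_split -sumrB; apply: eq_bigr => i _ /=.
  rewrite !mulr_sumr -big_split -sumrB; apply: eq_bigr => j _ /=.
  ring.
by apply: sumr_ge0 => i _; apply: sumr_ge0 => j _; exact: sqr_ge0.
Qed.

Lemma euclid_norm0 n : euclid_norm (0 : 'cV[R]_n) = 0.
Proof. by apply/eqP; rewrite euclid_norm_eq0. Qed.

(** Boundedness makes the supremum in [opnorm] a genuine one. On the unit ball each coordinate is at
    most 1 in absolute value, whence a bound by row sums. *)
Lemma has_ubound_opnorm n (A : 'M[R]_n) :
  has_ubound [set euclid_norm (A *m x) |
    x in [set x : 'cV[R]_n | euclid_norm x <= 1]].
Proof.
exists (Num.sqrt (\sum_i (\sum_j `|A i j|) ^+ 2)) => _ [x /= x1 <-].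
rewrite ler_sqrt; last by apply: sumr_ge0 => i _; exact: sqr_ge0.
have xj j : `|x j 0| <= 1.
  rewrite -ler_sqr ?nnegrE // expr1n real_normK ?num_real //.
  have := x1; rewrite euclid_norm_sqr_le // expr1n; apply: le_trans.
  rewrite dotmxE (bigD1 j) //= -expr2 lerDl; apply: sumr_ge0 => k _.
  exact: sqr_ge0.
apply: ler_sum => i _; rewrite mxE.
rewrite -[leLHS]real_normK ?num_real // ler_sqr ?nnegrE ?sumr_ge0 //.
apply: (le_trans (ler_norm_sum _ _ _)); apply: ler_sum => j _.
by rewrite normrM ler_piMr.
Qed.

Lemma opnorm_ge0 n (A : 'M[R]_n) : 0 <= opnorm A.
Proof.
apply: ub_le_sup; first exact: has_ubound_opnorm.
by exists 0; rewrite /= ?mulmx0 euclid_norm0.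
Qed.

Lemma opnorm_ub n (A : 'M[R]_n) (x : 'cV[R]_n) :
  euclid_norm (A *m x) <= opnorm A * euclid_norm x.
Proof.
have [->|x0] := eqVneq x 0; first by rewrite mulmx0 euclid_norm0 mulr0.
have nx0 : 0 < euclid_norm x.
  by rewrite lt_def euclid_norm_eq0 x0 euclid_norm_ge0.
rewrite -ler_pdivrMr // mulrC.
rewrite -[X in X * _]ger0_norm ?invr_ge0 ?euclid_norm_ge0 //.
rewrite -euclid_normZ scalemxAr.
apply: ub_le_sup; first exact: has_ubound_opnorm.
exists ((euclid_norm x)^-1 *: x) => //=.
by rewrite euclid_normZ normfV ger0_norm ?euclid_norm_ge0 // mulVf // gt_eqF.
Qed.

Lemma opnorm_le n (A : 'M[R]_n) c : 0 <= c ->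
  (forall x, euclid_norm (A *m x) <= c * euclid_norm x) -> opnorm A <= c.
Proof.
move=> c0 Ac; apply: ge_sup => [|_ [x /= x1 <-]].
  exists (euclid_norm (A *m 0)), 0 => //=.
  by rewrite euclid_norm0.
by rewrite (le_trans (Ac x)) // ler_piMr.
Qed.

(** |X^T x|^2 = x^T S x, which Cauchy-Schwarz bounds by |x| |S x|. *)
Lemma euclid_norm_trmx_le n (S X : 'M[R]_n) (x : 'cV[R]_n) : S = X *m X^T ->
  euclid_norm (X^T *m x) <= Num.sqrt (opnorm S) * euclid_norm x.
Proof.
move=> SX; rewrite euclid_norm_sqr_le ?mulr_ge0 ?sqrtr_ge0 ?euclid_norm_ge0 //.
rewrite exprMn sqr_sqrtr ?opnorm_ge0 //.
have -> : dotmx (X^T *m x) (X^T *m x) = dotmx x (S *m x).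
  by rewrite /dotmx trmx_mul trmxK SX !mulmxA.
apply: (le_trans (dotmx_le _ _)).
by rewrite mulrC expr2 mulrA ler_wpM2r ?euclid_norm_ge0 // opnorm_ub.
Qed.

(* Cauchy-Schwarz for |x|^2 = (X^T x) . (X^-1 x). *)
Lemma euclid_norm_le_trmx n (S X : 'M[R]_n) (x : 'cV[R]_n) :
    X \in unitmx -> S = X *m X^T ->
  euclid_norm x <= Num.sqrt (opnorm (invmx S)) * euclid_norm (X^T *m x).
Proof.
move=> Xu SX.
have SV : invmx S = (invmx X)^T *m (invmx X)^T^T.
  have XV : S *m ((invmx X)^T *m invmx X) = 1%:M.
    by rewrite SX trmx_inv !mulmxA mulmxK ?unitmx_tr // mulmxV.
  have [Su _] := mulmx1_unit XV.
  by rewrite trmxK -[LHS]mulmx1 -XV mulKmx.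
have [->|x0] := eqVneq x 0.
  by rewrite euclid_norm0 mulr_ge0 ?sqrtr_ge0 ?euclid_norm_ge0.
have nx0 : 0 < euclid_norm x.
  by rewrite lt_def euclid_norm_eq0 x0 euclid_norm_ge0.
rewrite -(ler_pM2r nx0) -expr2 sqr_euclid_norm.
have -> : dotmx x x = dotmx (X^T *m x) (invmx X *m x).
  by rewrite /dotmx trmx_mul trmxK -mulmxA mulKVmx.
apply: (le_trans (dotmx_le _ _)).
rewrite mulrAC mulrC ler_wpM2r ?euclid_norm_ge0 //.
(* Since S^-1 = X^-T X^-1, the bound for a factored matrix applies to S^-1 and controls |X^-1 x|. *)
by have := euclid_norm_trmx_le x SV; rewrite trmxK.
Qed.

End OperatorNorm.

(** * Construction of the optimal J and of its Lyapunov matrix *)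

Section LyapunovMatrix.
Variable R : realType.

(** This is D = diag(1, ..., n), indices starting at 0. Its entries are distinct, so off the
    diagonal no quotient below has denominator 0, and they lie between 1 and n. *)
Definition weightmx n : 'M[R]_n := diag_mx (\row_k k.+1%:R).

(* On the diagonal the quotient is a division by 0, hence the entry is 0. *)
Definition weighted_skew n (T : 'M[R]_n) : 'M[R]_n :=
  \matrix_(k, j) - ((k.+1%:R + j.+1%:R) / (k.+1%:R - j.+1%:R) * T k j).

Lemma weighted_skew_antisym n (T : 'M[R]_n) :
  T^T = T -> antisymmx (weighted_skew T).
Proof.
move=> Tsym; apply/matrixP => k j; rewrite !mxE -{1}Tsym mxE.
by rewrite -[X in _ / X]opprB invrN addrC; ring.
Qed.

(** Write d_k = k + 1. Off the diagonal, entry (k, j) of the left side is (d_k + d_j) T_kj + (d_k -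
    d_j) K_kj, and K is chosen to make it vanish. On the diagonal K is zero and 2 m d_k remains. *)
Lemma weighted_skew_lyapunov n (T : 'M[R]_n) m :
    T^T = T -> (forall k, T k k = m) ->
  let A := T + weighted_skew T in
  A^T *m weightmx n + weightmx n *m A = (2 * m) *: weightmx n.
Proof.
move=> Tsym Tm /=; apply/matrixP => k j.
rewrite /weightmx mul_mx_diag mul_diag_mx !mxE.
have Tjk : T j k = T k j by rewrite -[in LHS]Tsym mxE.
rewrite Tjk; have [<-|kj] := eqVneq k j.
  by rewrite Tm subrr invr0 mulr1n; ring.
have kj0 : k.+1%:R - j.+1%:R != 0 :> R by rewrite subr_eq0 eqr_nat eqSS.
have jk0 : j.+1%:R - k.+1%:R != 0 :> R by rewrite -opprB oppr_eq0.
by rewrite mulr0n; field; rewrite !nat1r kj0 jk0.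
Qed.

Lemma dotmx_weightmx n (x : 'cV[R]_n) :
  dotmx x (weightmx n *m x) = \sum_(k < n) k.+1%:R * x k 0 ^+ 2.
Proof.
rewrite dotmxE; apply: eq_bigr => k _; rewrite /weightmx mul_diag_mx !mxE; ring.
Qed.

Lemma dotmx_weightmx_ge n (x : 'cV[R]_n) :
  dotmx x x <= dotmx x (weightmx n *m x).
Proof.
rewrite dotmx_weightmx dotmxE; apply: ler_sum => k _.
by rewrite -expr2 ler_peMl ?sqr_ge0 // ler1n.
Qed.

Lemma dotmx_weightmx_le n (x : 'cV[R]_n) :
  dotmx x (weightmx n *m x) <= n%:R * dotmx x x.
Proof.
rewrite dotmx_weightmx dotmxE mulr_sumr; apply: ler_sum => k _.
by rewrite -expr2 ler_wpM2r ?sqr_ge0 // ler_nat.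
Qed.

Lemma posdefmx_unit n (S : 'M[R]_n) : posdefmx S -> S \in unitmx.
Proof.
move=> [_ Spos]; rewrite unitmxE unitfE; apply/negP => /det0P[v v0 vS].
have /Spos : v^T != 0 by rewrite -trmx0 (inj_eq trmx_inj).
by rewrite trmxK vS mul0mx mxE ltxx.
Qed.

Lemma trmx_mul_diag n (X : 'M[R]_n) k : (X^T *m X) k k = colnorm2 X k.
Proof. by rewrite mxE; apply: eq_bigr => p _; rewrite mxE expr2. Qed.

Lemma exists_optimal_antisym n (S : 'M[R]_n) : posdefmx S ->
  exists J X : 'M[R]_n, [/\ antisymmx J, X \in unitmx, S = X *m X^T &
    let B := (1%:M + J) *m S in let P := X *m weightmx n *m X^T in
    B^T *m P + P *m B = (2 * (\tr S / n%:R)) *: P].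
Proof.
move=> Spd; have [X0 SX0] := posdefmx_cholesky Spd.
have [X XX Xm] := exists_equal_colnorm X0; rewrite -SX0 in XX Xm.
have Xu : X \in unitmx.
  by have := posdefmx_unit Spd; rewrite -XX unitmx_mul => /andP[].
have XTu : X^T \in unitmx by rewrite unitmx_tr.
pose T := X^T *m X; pose K := weighted_skew T.
have Tsym : T^T = T by rewrite trmx_mul trmxK.
pose J := invmx X^T *m K *m invmx X.
have Janti : J^T = - J.
  rewrite !trmx_mul -trmx_inv trmxK (weighted_skew_antisym Tsym) /J -/K.
  by rewrite mulNmx mulmxN trmx_inv mulmxA.
exists J, X; split => //=.
(* B is T + K conjugated by X^T, so the identity for T + K and D turns into one for B and P = X D
   X^T. *)
have BE : (1%:M + J) *m S = invmx X^T *m (T + K) *m X^T.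
  rewrite mulmxDl mul1mx mulmxDr mulmxDl /T mulmxA mulVmx // mul1mx XX.
  by rewrite /J -XX mulmxA mulmxKV.
have := weighted_skew_lyapunov Tsym
  (fun k => etrans (trmx_mul_diag X k) (Xm k)).
rewrite -/K BE /= => AP.
transitivity (X *m ((T + K)^T *m weightmx n + weightmx n *m (T + K)) *m X^T).
  rewrite mulmxDr mulmxDl !trmx_mul trmxK trmx_inv trmxK !mulmxA.
  rewrite -[_ *m invmx X *m X]mulmxA mulVmx // mulmx1.
  by rewrite -[_ *m X^T *m invmx X^T]mulmxA mulmxV // mulmx1.
by rewrite AP -scalemxAr -scalemxAl.
Qed.

End LyapunovMatrix.

(** * The maximal decay rate and the norm estimate *)

Theorem theorem1 (R : realType) (N : nat) (hN : (0 < N)%N) :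
  exists C : R, forall S : 'M[R]_N, posdefmx S ->
    is_max [set min_Re ((1%:M + J) *m S) | J in @antisymmx R N]
           (\tr S / N%:R) /\
    exists Jopt : 'M[R]_N,
      [/\ antisymmx Jopt,
          min_Re ((1%:M + Jopt) *m S) = \tr S / N%:R &
          forall t : R, 0 <= t ->
            opnorm (expmx (- t *: ((1%:M + Jopt) *m S))) <=
            C * Num.sqrt (cond_number S) * expR (- (\tr S / N%:R) * t)].
Proof.
(* N is the ratio of the largest to the smallest entry of D; the root comes from passing from
   squared lengths to lengths. *)
exists (Num.sqrt N%:R) => S Spd.
set m := \tr S / N%:R.
have [J [X [Janti Xu SX]]] := exists_optimal_antisym Spd.
rewrite -/m; set B := (1%:M + J) *m S; set P := _ *m X^T => BP.
have qP x : (x^T *m P *m x) 0 0 = dotmx (X^T *m x) (weightmx R N *m (X^T *m x)).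
  by rewrite /dotmx /P trmx_mul trmxK !mulmxA.
have XTu : X^T \in unitmx by rewrite unitmx_tr.
have Ppd : posdefmx P.
  split; first by rewrite /P !trmx_mul trmxK tr_diag_mx mulmxA.
  move=> x x0; rewrite qP; apply: lt_le_trans (dotmx_weightmx_ge _).
  rewrite -sqr_euclid_norm exprn_gt0 // lt_def euclid_norm_ge0 andbT.
  rewrite euclid_norm_eq0.
  by apply: contra_neq x0 => Xx; rewrite -(mulKmx XTu x) Xx mulmx0.
have BJ : min_Re B = m.
  by have [[z zB <-] _] := min_ReP B hN; exact: spectrum_lyapunov BP zB.
split.
  split; first by exists J.
  move=> _ [K Kanti <-]; apply: le_trans (min_Re_le_trace _ hN) _.
  (* Transposition maps K S to - S K, so the trace equals its own negative. *)
  have trKS : \tr (K *m S) = 0.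
    have : \tr (K *m S) = - \tr (K *m S).
      rewrite -[LHS]mxtrace_tr trmx_mul Kanti (proj1 Spd) mulmxN raddfN /=.
      by rewrite mxtrace_mulC.
    by lra.
  by rewrite mulmxDl mul1mx mxtraceD trKS addr0.
exists J; split => // t t0; apply: opnorm_le => [|x].
  by rewrite !mulr_ge0 ?sqrtr_ge0 ?expR_ge0.
set y := expmx _ *m x.
(* The form of P dominates |X^T y|^2 and is multiplied exactly by exp(- 2 m t) along the flow:
   [expmx_congr_scale] is used at time - t with rate 2 m. Returning to |X^T x|^2 costs the factor
   N. *)
have yx : dotmx (X^T *m y) (X^T *m y) <=
    expR (2 * m * - t) * (N%:R * dotmx (X^T *m x) (X^T *m x)).
  apply: (le_trans (dotmx_weightmx_ge _)).
  apply: le_trans (ler_wpM2l (expR_ge0 _) (dotmx_weightmx_le _)).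
  rewrite -!qP /y trmx_mul; set E := expmx _.
  have -> : x^T *m E^T *m P *m (E *m x) = x^T *m (E^T *m P *m E) *m x.
    by rewrite !mulmxA.
  by rewrite (expmx_congr_scale (- t) BP) -scalemxAr -scalemxAl mxE.
have {}yx : euclid_norm (X^T *m y) <=
    expR (- m * t) * (Num.sqrt N%:R * euclid_norm (X^T *m x)).
  rewrite euclid_norm_sqr_le ?mulr_ge0 ?expR_ge0 ?sqrtr_ge0 ?euclid_norm_ge0 //.
  rewrite !exprMn sqr_euclid_norm sqr_sqrtr ?ler0n // expr2 -expRD.
  by rewrite (_ : - m * t + - m * t = 2 * m * - t) //; ring.
(* Passing from |y| to |X^T y| costs the root of |S^-1|, and from |X^T x| to |x| the root of |S|;
   together they give the root of the condition number. *)
apply: (le_trans (euclid_norm_le_trmx y Xu SX)).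
apply: (le_trans (ler_wpM2l (sqrtr_ge0 _) yx)).
have := euclid_norm_trmx_le x SX.
rewrite /cond_number sqrtrM ?opnorm_ge0 //.
set k := Num.sqrt (opnorm (invmx S)); set l := Num.sqrt (opnorm S) => Xx.
have -> : Num.sqrt N%:R * (l * k) * expR (- m * t) * euclid_norm x =
  k * (expR (- m * t) * (Num.sqrt N%:R * (l * euclid_norm x))) by ring.
by do 3 (apply: ler_wpM2l; first by rewrite ?sqrtr_ge0 ?expR_ge0).
Qed.
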